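(* Let $n \ge 2$ and let $x_1 < x_2 < \dots < x_n$ be real numbers (an ordered sample). For $i = 1,\dots,n$ set $$y_i = \frac{1}{n}\sum_{j=1}^n (x_i - x_j)\, I_{x_j \le x_i}.$$ Define the backward difference estimator at the sample points by $$\hat F_B(x_1) = 0, \qquad \hat F_B(x_i) = \frac{y_i-y_{i-1}}{x_i-x_{i-1}}\quad (i=2,\dots,n).$$ Then $$\hat F_B(x_1)=0, \qquad \hat F_B(x_i) = \frac{i-1}{n}\quad (i=2,\dots,n).$$
   Context: $I_A$ is $1$ if the condition $A$ holds and $0$ otherwise. The number $y_i$ is the empirical left mean absolute deviation function, i.e. the sample version of $v \mapsto E[(v-X)I_{X\le v}]$, evaluated at $v = x_i$. *)

(* Defs.v *)
From mathcomp Require Import all_boot all_order all_algebra.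
From mathcomp Require Import reals.

Set Implicit Arguments.
Unset Strict Implicit.
Unset Printing Implicit Defensive.

Import Order.TTheory GRing.Theory Num.Theory.
Local Open Scope ring_scope.

(* A sample x_1, ..., x_n is a function on 'I_n, so indices are shifted by one:
   [x i] is x_(i+1) in the usual 1-based numbering. *)

(* Sample version of v |-> E[(v - X) I_(X <= v)]; the boolean [x j <= v] is
   coerced to 0 or 1, hence plays the role of the indicator. *)
Definition emp_left_mad (R : realType) (n : nat) (x : 'I_n -> R) (v : R) : R :=
  n%:R^-1 * \sum_(j < n) (v - x j) * (x j <= v)%R%:R.

(* [ord_pred i] is the cyclic predecessor in 'I_n; it is the ordinary one in the
   branch where it is used, since there i is not the first index. *)
Definition backward_diff (R : realType) (n : nat) (x : 'I_n -> R) (i : 'I_n) : R :=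
  let y k := emp_left_mad x (x k) in
  if val i == 0%N then 0
  else (y i - y (ord_pred i)) / (x i - x (ord_pred i)).

(* Main.v *)
(* Only the x_j with j < i separate the sums in y_i and y_(i-1): each contributes
   x_i - x_(i-1), while x_i itself has weight 0 in both sums. Hence
   y_i - y_(i-1) is (x_i - x_(i-1)) / n times the number of such j. *)
Require Import Defs.
From mathcomp Require Import all_boot all_order all_algebra.
From mathcomp Require Import reals.
Import Order.TTheory GRing.Theory Num.Theory.
Local Open Scope ring_scope.

(** Turns indicators on sample values into conditions on indices; totality of the index order gives
    the converse. *)
Lemma incr_ord_le (R : realType) (n : nat) (x : 'I_n -> R)
    (hx : forall i j : 'I_n, (i < j)%N -> x i < x j) (i j : 'I_n) :
  (x i <= x j) = (i <= j)%N.
Proof.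
case: (ltngtP i j) => [/hx/ltW //|/hx|/val_inj ->]; last exact: lexx.
by rewrite ltNge => /negbTE.
Qed.

Lemma val_ord_pred (n : nat) (i : 'I_n) : (0 < i)%N -> ord_pred i = i.-1 :> nat.
Proof.
case: n i => [[]//|n] [[|i] Hi] //= _.
by rewrite modnDr modn_small // ltnW.
Qed.

Lemma sum_ord_lt (R : pzSemiRingType) (n i : nat) :
  (i <= n)%N -> \sum_(j < n) (j < i)%N%:R = i%:R :> R.
Proof.
move=> le_in; rewrite -natr_sum; congr (_%:R).
(* [nat_of_bool] is itself a conditional, so this is a filtered sum of ones, next cut to the range
   below [i]. *)
rewrite -big_mkcond -(big_mkord (fun j => j < i)%N (fun=> 1%N)).
by rewrite -[LHS](big_nat_widen 0 i n xpredT) // sum_nat_const_nat muln1 subn0.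
Qed.

(** The product form, with any [p] just before [i], keeps division by the gap and the cyclic
    predecessor out. *)
Lemma emp_left_mad_step (R : realType) (n : nat) (x : 'I_n -> R)
    (hx : forall i j : 'I_n, (i < j)%N -> x i < x j) (i p : 'I_n) :
  i = p.+1 :> nat ->
  emp_left_mad x (x i) - emp_left_mad x (x p) = (x i - x p) * (i%:R / n%:R).
Proof.
move=> ip; rewrite -mulrBr -sumrB mulrA [LHS]mulrC; congr (_ * _).
(* Expanding [i%:R] into indicators of [j < i] lets both sides be compared term by term. *)
have /sum_ord_lt <- := ltnW (ltn_ord i).
rewrite mulr_sumr; apply: eq_bigr => j _.
rewrite !(incr_ord_le _ _ _ hx) leq_eqVlt [in RHS]ip ltnS.
have -> : (j < i)%N = (j <= p)%N by rewrite ip.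
case: eqP => [/val_inj -> /=|_ /=].
  by rewrite ip ltnn subrr !(mul0r, mulr0) subrr.
by case: (j <= p)%N; rewrite ?mulr1 ?mulr0 ?subrr // opprB addrA subrK.
Qed.

Theorem theorem4 (R : realType) (n : nat) (hn : (2 <= n)%N) (x : 'I_n -> R)
    (hx : forall i j : 'I_n, (i < j)%N -> x i < x j) :
  (forall i : 'I_n, nat_of_ord i = 0%N -> backward_diff x i = 0) /\
  (* the 0-based index i is the 1-based index i + 1, so (i + 1) - 1 = i *)
  (forall i : 'I_n, (0 < i)%N -> backward_diff x i = i%:R / n%:R).
Proof.
split=> i; first by move=> i0; rewrite /backward_diff /= i0.
move=> i_gt0; rewrite /backward_diff /= eqn0Ngt i_gt0 /=.
(* As [0 < i], the predecessor does not wrap around. *)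
have ip : i = (ord_pred i).+1 :> nat by rewrite val_ord_pred // prednK.
have lt_x : x (ord_pred i) < x i by apply: hx; rewrite [ltnRHS]ip.
by rewrite (emp_left_mad_step _ _ _ hx _ _ ip) mulrAC divff ?mul1r // subr_eq0 gt_eqF.
Qed.
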